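(* The local complexity of the class of subgraphs of the square grid is $\Theta(n)$, and the local complexity of the class of induced subgraphs of the square grid is $\Theta(n)$.
   Context: The square grid is the infinite graph on $\mathbb{Z}^2$ with edges between points at Euclidean distance 1. All graphs are finite, simple, connected; $n$ is the number of vertices, with distinct identifiers in $\{1,\dots,\mathrm{poly}(n)\}$. A proof labeling scheme for a class $\mathcal{G}$ consists of a prover assigning a certificate (binary word) to each vertex of each $G\in\mathcal{G}$ and a local verifier where each vertex accepts or rejects based only on identifiers and certificates in its closed neighborhood; all vertices accept when $G\in\mathcal{G}$ with the prover's certificates, and when $G\notin\mathcal{G}$ some vertex rejects for every certificate assignment. The local complexity of $\mathcal{G}$ is the minimum, over such schemes, of the maximum certificate length used on $n$-vertex graphs of $\mathcal{G}$. *)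

(* Defs.v *)
From mathcomp Require Import all_boot all_order all_algebra.
Set Implicit Arguments. Unset Strict Implicit. Unset Printing Implicit Defensive.

Definition is_graph (n : nat) (e : rel 'I_n) : Prop :=
  symmetric e /\ irreflexive e /\ (forall u v : 'I_n, connect e u v).

Definition graph_class := forall n : nat, rel 'I_n -> Prop.

(* Square grid: points of Z^2 at Euclidean distance 1, i.e. l1-distance 1. *)
Definition grid_adj (p q : int * int) : bool :=
  (`|p.1 - q.1|%N + `|p.2 - q.2|%N == 1)%N.

Definition grid_subgraph : graph_class := fun n e =>
  exists f : 'I_n -> int * int, injective f /\
    (forall u v : 'I_n, e u v -> grid_adj (f u) (f v)).

Definition grid_induced_subgraph : graph_class := fun n e =>
  exists f : 'I_n -> int * int, injective f /\
    (forall u v : 'I_n, e u v = grid_adj (f u) (f v)).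

Definition valid_ids (k n : nat) (id : 'I_n -> nat) : Prop :=
  injective id /\ (forall v : 'I_n, 1 <= id v <= n ^ k)%N.

Definition cert_assign (n : nat) := 'I_n -> seq bool.

(* A local verifier sees its own identifier and certificate, and the list
   of (identifier, certificate) pairs of its neighbours, sorted by identifier
   (a canonical presentation of the set of neighbour data, since identifiers
   are distinct). *)
Definition verifier := nat -> seq bool -> seq (nat * seq bool) -> bool.

Definition nbr_view (n : nat) (e : rel 'I_n) (id : 'I_n -> nat)
    (c : cert_assign n) (v : 'I_n) : seq (nat * seq bool) :=
  sort (fun a b : nat * seq bool => (a.1 <= b.1)%N)
       [seq (id u, c u) | u <- enum [pred u | e v u]].

Definition all_accept (V : verifier) (n : nat) (e : rel 'I_n)
    (id : 'I_n -> nat) (c : cert_assign n) : Prop :=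
  forall v : 'I_n, V (id v) (c v) (nbr_view e id c v).

Definition pls (C : graph_class) (k : nat) (V : verifier) (s : nat -> nat)
  : Prop :=
  (forall (n : nat) (e : rel 'I_n) (id : 'I_n -> nat),
      is_graph e -> valid_ids k id -> C n e ->
      exists c : cert_assign n,
        (forall v, size (c v) <= s n)%N /\ all_accept V e id c) /\
  (forall (n : nat) (e : rel 'I_n) (id : 'I_n -> nat),
      is_graph e -> valid_ids k id -> ~ C n e ->
      forall c : cert_assign n, ~ all_accept V e id c).

Definition local_complexity_Theta_n (C : graph_class) (k : nat) : Prop :=
  (exists (V : verifier) (s : nat -> nat) (a N : nat),
      pls C k V s /\ forall n, (N <= n)%N -> (s n <= a * n)%N) /\
  (exists d N : nat, (0 < d)%N /\
      forall (V : verifier) (s : nat -> nat), pls C k V s ->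
        forall n, (N <= n)%N -> (n <= d * s n)%N).

(* Main.v *)
(* Upper bound: every vertex receives the same map, the moves of a walk of length
   at most 2n through all points of the embedded graph, together with its own
   position on it and the identifier of the vertex at the origin.  Each vertex
   checks that its neighbours have distinct positions adjacent to its own and
   that it sees the predecessor of each of its stops, so the walk lifts backwards
   from any vertex, uniquely, down to the origin.  As the origin is occupied by a
   single identifier, positions are injective.

   Lower bound: replace each point of a lattice path by a 2 x 2 block, linking
   consecutive blocks by two edges.  Any grid embedding of this "snake" is forced
   up to isometry, so it does not embed if the path meets itself.  Words x, y of m
   bits are coded by a hairpin whose arms are staircases following x and y, the
   second shifted by (2, -2); the arms stay apart if x = y, and meet if some bit is
   1 in x and 0 in y.  If the accepting certificates of the hairpins (x, x) and
   (y, y) agree on the two blocks at the turn, they can be glued into accepting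
   certificates of (x, y) and of (y, x), one of which does not embed.  Hence those
   eight certificates distinguish 2^m words. *)
Require Import Defs.
From mathcomp Require Import all_boot all_order all_algebra zify.
Set Implicit Arguments. Unset Strict Implicit. Unset Printing Implicit Defensive.
Import GRing.Theory.

(** * Adjacency in the square grid *)

Lemma grid_adjP (p q : int * int) : grid_adj p q ->
  [\/ q = (p.1 + 1, p.2)%R, q = (p.1 - 1, p.2)%R,
      q = (p.1, p.2 + 1)%R | q = (p.1, p.2 - 1)%R].
Proof.
case: p q => [a b] [c d]; rewrite /grid_adj /= => h.
have : c = (a + 1)%R /\ d = b \/ c = (a - 1)%R /\ d = b \/
  c = a /\ d = (b + 1)%R \/ c = a /\ d = (b - 1)%R by lia.
case=> [|[|[|]]] -[-> ->]; [exact: Or41|exact: Or42|exact: Or43|exact: Or44].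
Qed.

Lemma grid_adj_sym : symmetric grid_adj.
Proof. move=> p q; rewrite /grid_adj; lia. Qed.

(** * Certificates of linear size *)

Lemma all_nbr_view n (e : rel 'I_n) id (c : cert_assign n) v
    (a : pred (nat * seq bool)) :
  reflect (forall u, e v u -> a (id u, c u)) (all a (nbr_view e id c v)).
Proof.
rewrite /nbr_view all_sort all_map; apply: (iffP allP) => h u.
  by move=> evu; apply: h; rewrite mem_enum.
by rewrite mem_enum => /h.
Qed.

Lemma mem_nbr_view n (e : rel 'I_n) id (c : cert_assign n) v
    (T : eqType) (g : seq bool -> T) q :
  reflect (exists2 u, e v u & g (c u) = q) (q \in [seq g a.2 | a <- nbr_view e id c v]).
Proof.
rewrite /nbr_view; apply: (iffP mapP) => [[a]|[u evu <-]].
  by rewrite mem_sort => /mapP [u]; rewrite mem_enum => evu -> ->; exists u.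
exists (id u, c u) => //; rewrite mem_sort.
by apply: (map_f (fun u => (id u, c u))); rewrite mem_enum.
Qed.

Lemma uniq_nbr_view n (e : rel 'I_n) id (c : cert_assign n) v
    (T : eqType) (g : seq bool -> T) :
  reflect {in e v &, injective (g \o c)} (uniq [seq g a.2 | a <- nbr_view e id c v]).
Proof.
have -> : uniq [seq g a.2 | a <- nbr_view e id c v] =
    uniq [seq g (c u) | u <- enum [pred u | e v u]].
  rewrite (perm_uniq (perm_map _ (permEl (perm_sort _ _)))) -map_comp.
  by [].
apply: (iffP idP) => [U u w hu hw /= eg|inj].
  have := (uniqP (g (c u)) U) (index u (enum [pred u | e v u])) (index w (enum [pred u | e v u])).
  rewrite !inE !size_map !index_mem !mem_enum => /(_ hu hw).
  rewrite !(nth_map u) ?index_mem ?mem_enum // !nth_index ?mem_enum // => /(_ eg) ei.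
  rewrite -[u](@nth_index _ u u (enum [pred u | e v u])) ?mem_enum // ei.
  by rewrite nth_index ?mem_enum.
rewrite map_inj_in_uniq ?enum_uniq // => u w; rewrite !mem_enum; exact: inj.
Qed.

(** Connectivity gives an edge from a visited [u] to a new [z]. Inserting the detour [z, u] after a
    visit of [u] costs two steps per new vertex. *)
Lemma covering_walk n (e : rel 'I_n) (x : 'I_n) : is_graph e ->
  exists p, [/\ path e x p, size p <= 2 * n & forall v, v \in x :: p].
Proof.
case=> symE [_ conE].
suff [p [pp sp cp]] : exists p, [/\ path e x p, size p <= 2 * n.-1 & n.-1 < #|x :: p|].
  exists p; split=> //; first by apply: leq_trans sp _; rewrite leq_mul2l leq_pred orbT.
  have /subset_cardP S : #|x :: p| = #|'I_n|.
    by apply/eqP; rewrite eqn_leq max_card card_ord -[leqLHS](ltn_predK (ltn_ord x)).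
  by move=> v; rewrite (elimT S (subset_predT _)).
elim: {-2}n.-1 (leqnn n.-1) => [|m IH] hm.
  by exists [::]; split=> //; rewrite (eq_card (B := pred1 x)) ?card1 // => v; rewrite !inE.
have [p [pp sp cp]] := IH (ltnW hm).
have [h|h] := ltnP m.+1 #|x :: p|; first by exists p; split=> //; lia.
have [w wp] : exists w, w \notin x :: p.
  apply/existsP; rewrite -[X in is_true X]negbK negb_exists; apply/negP => /forallP all_in.
  suff: n <= #|x :: p| by lia.
  rewrite -[X in X <= _]card_ord; apply: subset_leq_card; apply/subsetP => v _.
  by have := all_in v; rewrite negbK.
have [u [z [up zp euz]]] : exists u z, [/\ u \in x :: p, z \notin x :: p & e u z].
  case: (pickP (fun uz : 'I_n * 'I_n => [&& uz.1 \in x :: p, uz.2 \notin x :: p & e uz.1 uz.2])).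
    by move=> [u z] /and3P[*]; exists u, z.
  move=> none; have cl : closed e (mem (x :: p)).
    apply: intro_closed; first exact: sym_connect_sym.
    move=> u z euz up; apply/negPn/negP => zp.
    by have := none (u, z); rewrite /= up zp euz.
  by have := closed_connect cl (conE x w); rewrite mem_head (negbTE wp).
move: pp sp cp zp; rewrite {h}; case/splitPl: up => p1 p2 l1.
rewrite cat_path l1 => /andP[pp1 pp2] sp cp zp.
exists (p1 ++ [:: z, u & p2]); split.
- by rewrite cat_path pp1 l1 /= euz symE euz.
- by move: sp; rewrite !size_cat /=; lia.
- apply: leq_trans (_ : #|z |: [set v in x :: p1 ++ p2]| <= _).
    by rewrite cardsU1 inE zp cardsE.
  apply: subset_leq_card; apply/subsetP => v; rewrite !inE !mem_cat !inE.
  by case/orP => [->|/or3P[]->]; rewrite ?orbT.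
Qed.

(** A self-delimiting code: [true] announces a bit, [false] closes a word. Decoding is total, as the
    verifier meets arbitrary certificates. *)
Fixpoint unpack (s : seq bool) : seq (seq bool) :=
  match s with
  | true :: b :: s' => (b :: head [::] (unpack s')) :: behead (unpack s')
  | false :: s' => [::] :: unpack s'
  | _ => [::]
  end.

Definition pack (ls : seq (seq bool)) : seq bool :=
  flatten [seq flatten [seq [:: true; b] | b <- l] ++ [:: false] | l <- ls].

Lemma packK : cancel pack unpack.
Proof.
elim=> // l ls IH; rewrite /pack /= -catA; elim: l => [|b l IHl] /=.
  by rewrite -/(pack ls) IH.
by rewrite IHl.
Qed.

Lemma size_pack ls : size (pack ls) = \sum_(l <- ls) (size l).*2.+1.
Proof.
elim: ls => [|l ls IH]; first by rewrite big_nil.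
rewrite big_cons -IH /pack /= size_cat size_cat /= addn1; congr (_.+1 + _).
by elim: l => //= b l ->; rewrite doubleS.
Qed.

Definition bits_val : seq bool -> nat := foldr (fun (b : bool) v => b + v.*2) 0.

Lemma bits_val_surj L a : a < 2 ^ L -> exists2 r, size r = L & bits_val r = a.
Proof.
elim: L a => [|L IH] a; first by case: a => // _; exists [::].
rewrite expnS => h; have /IH [r sr vr] : a./2 < 2 ^ L by lia.
by exists (odd a :: r) => /=; rewrite ?sr ?vr ?odd_double_half.
Qed.

Definition grid_move (p : int * int) (d : bool * bool) : int * int :=
  let s : int := if d.2 then 1%R else (-1)%R in
  if d.1 then (p.1 + s, p.2)%R else (p.1, p.2 + s)%R.

Lemma path_moves p qs : path grid_adj p qs ->
  exists W1 W2, [/\ size W1 = size qs, size W2 = size qs & scanl grid_move p (zip W1 W2) = qs].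
Proof.
elim: qs p => [|q qs IH] p /=; first by exists [::], [::].
case/andP => pq /IH [W1 [W2 [s1 s2 e]]].
suff [b1 [b2 eb]] : exists b1 b2, grid_move p (b1, b2) = q.
  by exists (b1 :: W1), (b2 :: W2); rewrite /= s1 s2 eb e.
by case/grid_adjP: pq => ->; [exists true, true|exists true, false|
  exists false, true|exists false, false].
Qed.

(* A certificate packs [:: W1; W2; r; l]: the bits of the moves of a walk from
   the origin, the identifier [r] of the vertex placed at the origin, and a list
   [l] whose length is the index on the walk of the position of the vertex. *)
Definition shared (c : seq bool) : seq (seq bool) := take 3 (unpack c).
Definition root_id (c : seq bool) : nat := bits_val (nth [::] (shared c) 2).
Definition stops (c : seq bool) : seq (int * int) :=
  (0, 0)%R :: scanl grid_move (0, 0)%R (zip (nth [::] (shared c) 0) (nth [::] (shared c) 1)).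
Definition stop_index (c : seq bool) : nat := size (nth [::] (unpack c) 3).
Definition cert_pos (c : seq bool) : int * int := nth (0, 0)%R (stops c) (stop_index c).

(** The first test makes every position a stop of the walk. Hence the last one, which only searches
    the stops, finds every missing edge of an induced embedding. *)
Definition grid_verifier (induced : bool) : verifier := fun id c nb =>
  let qs := [seq cert_pos a.2 | a <- nb] in
  [&& stop_index c < size (stops c),
      all (fun a => shared a.2 == shared c) nb,
      all (fun a => grid_adj (cert_pos c) (cert_pos a.2)) nb,
      uniq qs,
      (cert_pos c == (0, 0)%R) ==> (root_id c == id),
      all (fun j => (nth (0, 0)%R (stops c) j.+1 == cert_pos c) ==>
                    (nth (0, 0)%R (stops c) j \in qs)) (iota 0 (size (stops c)).-1)
    & induced ==> all (fun q => grid_adj (cert_pos c) q ==> (q \in qs)) (stops c)].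

Definition grid_class (induced : bool) : graph_class :=
  if induced then grid_induced_subgraph else grid_subgraph.

Lemma grid_verifier_complete k n (e : rel 'I_n) (id : 'I_n -> nat) induced :
  0 < k -> is_graph e -> valid_ids k id -> grid_class induced e ->
  exists c : cert_assign n,
    (forall v, size (c v) <= (16 + 2 * k) * n) /\ all_accept (grid_verifier induced) e id c.
Proof.
move=> k0 ge [injid idn] ce.
have {ce} [f [injf homf indf]] : exists f : 'I_n -> int * int, [/\ injective f,
    forall u v, e u v -> grid_adj (f u) (f v) &
    induced -> forall u v, grid_adj (f u) (f v) -> e u v].
  case: induced ce => -[f [injf ef]]; exists f; split=> //.
    by move=> u v; rewrite ef.
  by move=> _ u v; rewrite ef.
case: n e id ge injid idn f injf homf indf => [|n] e id ge injid idn f injf homf indf.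
  by exists (fun=> [::]); split=> -[].
pose x : 'I_n.+1 := ord0.
have [p [pp sp cov]] := covering_walk x ge.
pose g v := (f v - f x)%R.
have gx : g x = (0, 0)%R by rewrite /g subrr.
have injg : injective g by move=> u v /addIr /injf.
have gadj u v : grid_adj (g u) (g v) = grid_adj (f u) (f v).
  rewrite /g; case: (f u) (f v) (f x) => [a a'] [b b'] [d d']; rewrite /grid_adj /=; lia.
have [W1 [W2 [sW1 sW2 eW]]] : exists W1 W2, [/\ size W1 = size (map g p),
    size W2 = size (map g p) & scanl grid_move (g x) (zip W1 W2) = map g p].
  apply: path_moves; rewrite path_map; apply: sub_path pp => u v.
  by rewrite /= gadj; apply: homf.
(* With N vertices, identifiers are at most [N^k < 2^(k * N)]. *)
have [r sr vr] : exists2 r, size r = k * n.+1 & bits_val r = id x.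
  apply: bits_val_surj; apply: (@leq_ltn_trans (n.+1 ^ k)); first by case/andP: (idn x).
  by rewrite mulnC expnM ltn_exp2r // ltn_expl.
pose c v := pack [:: W1; W2; r; nseq (index v (x :: p)) true].
have shc v : shared (c v) = [:: W1; W2; r] by rewrite /shared packK.
have stc v : stops (c v) = map g (x :: p) by rewrite /stops shc /= -gx eW.
have ixc v : stop_index (c v) = index v (x :: p) by rewrite /stop_index packK /= size_nseq.
have pc v : cert_pos (c v) = g v.
  by rewrite /cert_pos stc ixc (nth_map x) ?index_mem ?cov // nth_index ?cov.
exists c; split=> [v|v].
  (* Both move words and the unary index have length at most 2N. Doubling and four terminators give
     at most [12N + 2kN + 4] bits. *)
  rewrite size_pack !big_cons big_nil sW1 sW2 size_map sr size_nseq.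
  have : index v (x :: p) < (size p).+1 by rewrite index_mem cov.
  lia.
have inqs u : e v u -> g u \in [seq cert_pos a.2 | a <- nbr_view e id c v].
  by move=> evu; apply/mem_nbr_view; exists u; rewrite ?pc.
apply/and5P; split; last (apply/and3P; split).
- by rewrite ixc stc size_map index_mem cov.
- by apply/all_nbr_view => u _ /=; rewrite !shc.
- by apply/all_nbr_view => u evu /=; rewrite !pc gadj; apply: homf.
- by apply/uniq_nbr_view => u w _ _ /=; rewrite !pc => /injg.
- by rewrite pc -gx; apply/implyP => /eqP/injg ->; rewrite /root_id shc /= vr.
- rewrite stc pc; apply/allP => j; rewrite mem_iota add0n /= size_map => hj.
  apply/implyP => /eqP; rewrite (nth_map x) // => /injg ev.
  rewrite -/(map g (x :: p)) (nth_map x) ?ltnS ?(ltnW hj) //; apply: inqs.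
  by rewrite (proj1 ge) -ev; apply: (pathP x pp).
- apply/implyP => ind; rewrite stc pc; apply/allP => q /mapP [u _ ->].
  by apply/implyP; rewrite gadj => /(indf ind) /inqs.
Qed.

Lemma grid_verifier_sound k n (e : rel 'I_n) (id : 'I_n -> nat) induced (c : cert_assign n) :
  is_graph e -> valid_ids k id -> all_accept (grid_verifier induced) e id c ->
  grid_class induced e.
Proof.
move=> [symE [_ conE]] [injid _] acc.
have shE u v : shared (c u) = shared (c v).
  have step a b : e a b -> shared (c a) = shared (c b).
    by case/and3P: (acc a) => _ /all_nbr_view h _ /h /eqP.
  have /connectP [p pp ->] := conE u v.
  by elim: p u pp => //= w p IH u /andP[/step -> /IH].
have stE u v : stops (c u) = stops (c v) by rewrite /stops (shE u v).
have adjP u v : e u v -> grid_adj (cert_pos (c u)) (cert_pos (c v)).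
  by case/and4P: (acc u) => _ _ /all_nbr_view h _ /h.
have uniqP v u w : e v u -> e v w -> cert_pos (c u) = cert_pos (c w) -> u = w.
  by case/and5P: (acc v) => _ _ _ /uniq_nbr_view h _ ? ? ?; apply: h.
(* Induction along the walk. At stop 0, [u] and [v] both carry the root identifier. At stop [j.+1],
   each has a neighbour at stop [j]; by induction it is the same vertex [z], and the neighbours of
   [z] have distinct positions. *)
have atP j u v : j < size (stops (c u)) ->
   cert_pos (c u) = nth (0, 0)%R (stops (c u)) j -> cert_pos (c v) = cert_pos (c u) -> u = v.
  elim: j u v => [|j IH] u v hj pu pv.
    have idP w : cert_pos (c w) = (0, 0)%R -> root_id (c w) = id w.
      by case/and5P: (acc w) => _ _ _ _ /and3P[/implyP h _ _] /eqP /h /eqP.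
    by apply: injid; rewrite -!idP ?pv // /root_id (shE u v).
  have back w : cert_pos (c w) = cert_pos (c u) ->
      exists2 z, e w z & cert_pos (c z) = nth (0, 0)%R (stops (c u)) j.
    move=> pw; case/and5P: (acc w) => _ _ _ _ /and3P[_ /allP h _].
    have /h : j \in iota 0 (size (stops (c w))).-1.
      by rewrite mem_iota add0n (stE w u) /=; move: hj; rewrite /stops /= ltnS.
    by rewrite (stE w u) pw pu eqxx => /mem_nbr_view.
  have [z uz pz] := back u erefl; have [y vy py] := back v pv.
  have zy : z = y by apply: IH; rewrite ?(stE z u) ?py ?pz //; apply: ltnW.
  by apply: (uniqP z); [rewrite symE|rewrite symE zy|rewrite pv].
have injP : injective (cert_pos \o c).
  move=> u v /= puv; case/andP: (acc u) => hu _.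
  by apply: (atP (stop_index (c u))).
case: induced acc => acc; exists (cert_pos \o c); split=> // u v.
apply/idP/idP => [|/= a]; first exact: adjP.
case/and5P: (acc u) => _ _ _ _ /and3P[_ _ /allP h].
have /h : cert_pos (c v) \in stops (c u).
  by rewrite (stE u v); apply: mem_nth; case/andP: (acc v).
by rewrite a => /mem_nbr_view [w uw /injP <-].
Qed.

(** * Snakes and their rigidity *)

(** A 4-cycle of the grid bounds a unit square, so three corners determine the fourth. *)
Lemma grid_square (p q r s : int * int) :
  grid_adj p q -> grid_adj q s -> grid_adj p r -> grid_adj r s ->
  p != s -> q != r -> s = (q + r - p)%R.
Proof.
move: p q r s => [p1 p2] [q1 q2] [r1 r2] [s1 s2].
move=> /grid_adjP + /grid_adjP + /grid_adjP.
rewrite /grid_adj !xpair_eqE /=.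
case=> -[-> ->]; case=> -[-> ->]; case=> -[-> ->] /= h nps nqr;
  by congr pair => /=; lia.
Qed.

(** The step [s] is orthogonal to the rung [a1 b1]. Of the four neighbours of [a1], two are [a0] and
    [b1], and the one opposite [b1] would put [b2] on [a1]; only [a1 + s] is left for [a2]. *)
Lemma ladder_step (a0 b0 a1 b1 a2 b2 s : int * int) :
  a1 = (a0 + s)%R -> b1 = (b0 + s)%R ->
  grid_adj a0 a1 -> grid_adj a1 b1 -> a0 != b1 -> b0 != a1 ->
  grid_adj a1 a2 -> grid_adj b1 b2 -> grid_adj a2 b2 ->
  a2 != a0 -> a2 != b1 -> b2 != a1 ->
  a2 = (a1 + s)%R /\ b2 = (b1 + s)%R.
Proof.
move=> ea eb a01 a1b1 n1 n2 a12 b12 a2b2 n3 n4 n5.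
have e2 : b2 = (b1 + a2 - a1)%R by apply: grid_square; rewrite // eq_sym.
move: n5 n3; rewrite e2 => {e2 a2b2 b12 b2}.
move: a0 b0 a1 b1 a2 s ea eb a01 a1b1 n1 n2 a12 n4.
move=> [a01 a02] [b01 b02] [a1 a1'] [b1 b1'] [a2 a2'] [s s'] [-> ->] [-> ->].
move=> /grid_adjP + /grid_adjP + + + /grid_adjP.
rewrite !xpair_eqE /=.
case=> -[h1 h2]; case=> -[h3 h4] /= n1 n2; case=> -[-> ->] /= n3 n4 n5;
  by split; congr pair => /=; lia.
Qed.

(** The side [x1 y1] faces the next block. One ladder step crosses the link, another the next
    block. *)
Lemma block_step (x0 x1 y0 y1 x0' x1' y0' y1' s : int * int) :
  uniq [:: x0; x1; y0; y1; x0'; x1'; y0'; y1'] ->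
  x1 = (x0 + s)%R -> y1 = (y0 + s)%R ->
  grid_adj x0 x1 -> grid_adj x1 y1 ->
  grid_adj x1 x0' -> grid_adj y1 y0' ->
  grid_adj x0' x1' -> grid_adj y0' y1' ->
  grid_adj x0' y0' -> grid_adj x1' y1' ->
  [/\ x0' = (x1 + s)%R, y0' = (y1 + s)%R, x1' = (x0' + s)%R & y1' = (y0' + s)%R].
Proof.
rewrite /= !inE !negb_or -!andbA => U ex ey x01 xy1 xx yy xx' yy' xy0' xy1'.
do ! [case/andP: U => ? U].
have [e1 e2] : x0' = (x1 + s)%R /\ y0' = (y1 + s)%R.
  by apply: (ladder_step ex ey) => //; rewrite eq_sym.
have [e3 e4] : x1' = (x0' + s)%R /\ y1' = (y0' + s)%R.
  by apply: (ladder_step e1 e2) => //; rewrite eq_sym.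
by [].
Qed.

Lemma pair_ext (T U : Type) (p q : T * U) : p.1 = q.1 -> p.2 = q.2 -> p = q.
Proof. by case: p q => [? ?] [? ?] /= -> ->. Qed.

Lemma mulrz2 (V : zmodType) (x : V) : (x *~ 2 = x + x)%R.
Proof. exact: mulr2n. Qed.

(* Vertex [4 * i + 2 * b + a] is the corner [(a, b)] of the block placed at [P i]. *)
Definition snake_pos (P : nat -> int * int) (v : nat) : int * int :=
  (2 * (P (v %/ 4)%N).1 + (v %% 2)%N%:Z, 2 * (P (v %/ 4)%N).2 + (v %/ 2 %% 2)%N%:Z)%R.

(** Joining only equal or consecutive blocks keeps the blocks in line even where the path meets
    itself, and makes adjacency depend on the path locally. *)
Definition snake (P : nat -> int * int) : rel nat := fun u v =>
  [&& u %/ 4 <= (v %/ 4).+1, v %/ 4 <= (u %/ 4).+1 & grid_adj (snake_pos P u) (snake_pos P v)]%N.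

Lemma snake_posE P i o : (o < 4)%N ->
  snake_pos P (i * 4 + o) = (2 * (P i).1 + (o %% 2)%N%:Z, 2 * (P i).2 + (o %/ 2)%N%:Z)%R.
Proof.
move=> o4; rewrite /snake_pos divnMDl // (divn_small o4) addn0.
by congr (_ + _%:Z, _ + _%:Z)%R; lia.
Qed.

Lemma snakeE P i j o o' : (o < 4)%N -> (o' < 4)%N ->
  snake P (i * 4 + o) (j * 4 + o') = [&& i <= j.+1, j <= i.+1 &
  grid_adj (2 * (P i).1 + (o %% 2)%N%:Z, 2 * (P i).2 + (o %/ 2)%N%:Z)%R
           (2 * (P j).1 + (o' %% 2)%N%:Z, 2 * (P j).2 + (o' %/ 2)%N%:Z)%R]%N.
Proof.
move=> h h'; rewrite /snake !snake_posE // !divnMDl //.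
by rewrite (divn_small h) (divn_small h') !addn0.
Qed.

(** The sides [a] and [b] of block 0 are carried from block to block by [block_step], so the origin
    of a block is an affine function of its point [P i]; [c] is fitted to block 0. *)
Lemma snake_rigid (P : nat -> int * int) n (F : nat -> int * int) :
  (forall i, grid_adj (P i) (P i.+1)) ->
  {in gtn n &, injective F} ->
  {in gtn n &, forall u v, snake P u v -> grid_adj (F u) (F v)} ->
  exists a b c, forall i, (i * 4 + 3 < n)%N ->
    [/\ F (i * 4 + 0)%N = (c + a *~ (2 * (P i).1) + b *~ (2 * (P i).2))%R,
        F (i * 4 + 1)%N = (F (i * 4 + 0)%N + a)%R, F (i * 4 + 2)%N = (F (i * 4 + 0)%N + b)%R &
        F (i * 4 + 3)%N = (F (i * 4 + 0)%N + a + b)%R].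
Proof.
move=> stepP injF homF.
have inner i o o' : (i * 4 + 3 < n)%N -> (o < 4)%N -> (o' < 4)%N ->
    grid_adj ((o %% 2)%N%:Z, (o %/ 2)%N%:Z)%R ((o' %% 2)%N%:Z, (o' %/ 2)%N%:Z)%R ->
    grid_adj (F (i * 4 + o)%N) (F (i * 4 + o')%N).
  move=> hi h h' hoo; apply: homF; rewrite ?inE; try lia.
  rewrite snakeE // !leqnSn /=; move: hoo; rewrite /grid_adj /=; lia.
have outer i o o' : (i.+1 * 4 + 3 < n)%N -> (o < 4)%N -> (o' < 4)%N ->
    grid_adj (2 * (P i).1 + (o %% 2)%N%:Z, 2 * (P i).2 + (o %/ 2)%N%:Z)%R
     (2 * (P i.+1).1 + (o' %% 2)%N%:Z, 2 * (P i.+1).2 + (o' %/ 2)%N%:Z)%R ->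
    grid_adj (F (i * 4 + o)%N) (F (i.+1 * 4 + o')%N).
  move=> hi h h' hoo; apply: homF; rewrite ?inE; try lia.
  by rewrite snakeE // leqnn leqW.
have neqF u v : (u < n)%N -> (v < n)%N -> u != v -> F u != F v.
  by move=> hu hv; apply: contra_neq => /injF; apply.
set a := (F 1%N - F 0%N)%R; set b := (F 2%N - F 0%N)%R.
exists a, b, (F 0%N - a *~ (2 * (P 0%N).1) - b *~ (2 * (P 0%N).2))%R.
elim=> [|i IH] hi.
  rewrite !mul0n !add0n; split.
  - by rewrite addrAC subrK subrK.
  - by rewrite /a addrC subrK.
  - by rewrite /b addrC subrK.
  - rewrite /a [(F 0%N + _)%R]addrC subrK /b addrA.
    apply: grid_square; try (by apply: neqF; lia).
    + exact: (@inner 0 0 1)%N.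
    + exact: (@inner 0 1 3)%N.
    + exact: (@inner 0 0 2)%N.
    + exact: (@inner 0 2 3)%N.
have hi' : (i * 4 + 3 < n)%N by lia.
have [] := IH hi' => E0 E1 E2 E3.
have U o0 o1 o2 o3 : uniq [:: o0; o1; o2; o3] -> all (gtn 4) [:: o0; o1; o2; o3] ->
   uniq [:: F (i * 4 + o0); F (i * 4 + o1); F (i * 4 + o2); F (i * 4 + o3);
            F (i.+1 * 4 + o0); F (i.+1 * 4 + o1); F (i.+1 * 4 + o2); F (i.+1 * 4 + o3)]%N.
  move=> uo ao; rewrite -[X in uniq X]/(map F [:: i * 4 + o0; i * 4 + o1; i * 4 + o2; i * 4 + o3;
            i.+1 * 4 + o0; i.+1 * 4 + o1; i.+1 * 4 + o2; i.+1 * 4 + o3]%N).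
  rewrite map_inj_in_uniq.
    move: uo ao; rewrite /= !inE; lia.
  by rewrite /= in ao; move=> u v; rewrite !inE => hu hv; apply: injF; rewrite inE; lia.
have I' := inner i.+1 _ _ hi; have I := inner i _ _ hi'; have O := outer i _ _ hi.
have /grid_adjP := stepP i.
(* For a step right, left, up or down, the corners are listed so that the second and fourth form the
   side facing the next block. *)
case=> eP; rewrite eP /=;
  [have [||||||||||] := @block_step _ _ _ _ _ _ _ _ a (U 0 1 2 3 isT isT)%N
  |have [||||||||||] := @block_step _ _ _ _ _ _ _ _ (-a)%R (U 1 0 3 2 isT isT)%N
  |have [||||||||||] := @block_step _ _ _ _ _ _ _ _ b (U 0 2 1 3 isT isT)%N
  |have [||||||||||] := @block_step _ _ _ _ _ _ _ _ (-b)%R (U 2 0 3 1 isT isT)%N].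
all: try (by apply: I || by apply: I').
all: try (by apply: O => //; rewrite eP /grid_adj /=; lia).
all: rewrite ?mulrDr ?mulrBr ?mulr1 ?mulrzDr ?mulrzBr ?mulrz2 ?E3 ?E2 ?E1 ?E0.
all: try (by apply: pair_ext => /=; lia).
all: move=> e0 e1 e2 e3; move: (congr1 fst e0) (congr1 snd e0) (congr1 fst e1)
  (congr1 snd e1) (congr1 fst e2) (congr1 snd e2) (congr1 fst e3) (congr1 snd e3) => /=.
all: by split; apply: pair_ext => /=; lia.
Qed.

Definition snake_graph (P : nat -> int * int) n : rel 'I_n := fun u v => snake P u v.

(** By rigidity, the origins of blocks [i] and [j] have the same image. *)
Lemma snake_collision (P : nat -> int * int) n i j :
  (forall i, grid_adj (P i) (P i.+1)) ->
  (i * 4 + 3 < n)%N -> (j * 4 + 3 < n)%N -> i != j -> P i = P j ->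
  ~ grid_subgraph (@snake_graph P n).
Proof.
move=> stepP hi hj ij eP [f [injf homf]].
pose F v := oapp f (0, 0)%R (insub v).
have FE v (hv : (v < n)%N) : F v = f (Ordinal hv) by rewrite /F insubT.
have injF : {in gtn n &, injective F}.
  move=> u v; rewrite !inE => hu hv; rewrite !FE => /injf; by case.
have homF : {in gtn n &, forall u v, snake P u v -> grid_adj (F u) (F v)}.
  by move=> u v; rewrite !inE => hu hv h; rewrite !FE; apply: homf.
have [a [b [c rig]]] := snake_rigid stepP injF homF.
have [Ei _ _ _] := rig i hi; have [Ej _ _ _] := rig j hj.
have : F (i * 4 + 0)%N = F (j * 4 + 0)%N by rewrite Ei Ej eP.
move/injF; rewrite !inE; lia.
Qed.

(** The standard drawing [snake_pos] works: corners of distinct blocks can be adjacent only if the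
    points of these blocks are. *)
Lemma snake_graph_induced (P : nat -> int * int) n :
  injective P ->
  (forall i j, grid_adj (P i) (P j) -> (i <= j.+1)%N) ->
  grid_induced_subgraph (@snake_graph P n).
Proof.
move=> injP adjP; exists (fun v => snake_pos P v); split=> [u v|u v].
  case => e1 e2; apply: val_inj => /=.
  have : P (u %/ 4)%N = P (v %/ 4)%N by apply: pair_ext; lia.
  move/injP; lia.
rewrite /snake_graph /snake; case h: (grid_adj (snake_pos P u) (snake_pos P v));
  last by rewrite !andbF.
have [->|ne] := eqVneq (u %/ 4)%N (v %/ 4)%N; first by rewrite !leqnSn.
have neP : P (u %/ 4)%N != P (v %/ 4)%N by apply: contra_neq ne => /injP.
suff a : grid_adj (P (u %/ 4)%N) (P (v %/ 4)%N).
  by rewrite (adjP _ _ a) (adjP _ (u %/ 4)%N) // grid_adj_sym.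
move: neP h; rewrite /snake_pos /grid_adj /=.
case: (P (u %/ 4)%N) (P (v %/ 4)%N) => [a b] [c d]; rewrite xpair_eqE /=.
lia.
Qed.

(* An incomplete last block is reached through its corner [0], which faces the
   previous block only if the last step goes right or up. *)
Lemma snake_graph_connected (P : nat -> int * int) n T :
  (forall i, grid_adj (P i) (P i.+1)) ->
  (forall i, (T <= i)%N -> ((P i).1 <= (P i.+1).1 /\ (P i).2 <= (P i.+1).2)%R) ->
  (T * 4 + 3 < n)%N ->
  is_graph (@snake_graph P n).
Proof.
move=> stepP upP hT.
have symS : symmetric (@snake_graph P n).
  by move=> u v; rewrite /snake_graph /snake grid_adj_sym andbCA.
split=> //; split.
  move=> u; rewrite /snake_graph /snake /grid_adj !subrr !absz0 /=; lia.
have n0 : (0 < n)%N by lia.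
have E (u v : nat) (hu : (u < n)%N) (hv : (v < n)%N) : snake P u v ->
    connect (@snake_graph P n) (Ordinal hu) (Ordinal hv).
  by move=> h; apply: connect1.
suff c0 v (hv : (v < n)%N) : connect (@snake_graph P n) (Ordinal n0) (Ordinal hv).
  case=> u hu [v hv]; apply: connect_trans (c0 v hv).
  by rewrite (sym_connect_sym symS).
have below u w (hu : (u < n)%N) (hw : (w < n)%N) :
    connect (@snake_graph P n) (Ordinal n0) (Ordinal hu) -> snake P u w ->
    connect (@snake_graph P n) (Ordinal n0) (Ordinal hw).
  by move=> c0 h; apply: connect_trans c0 (E _ _ hu hw h).
elim/ltn_ind: v hv => v IH hv.
have down o : (v %% 4)%N = o -> v = (v %/ 4 * 4 + o)%N by lia.
have : (v %% 4 < 4)%N by rewrite ltn_mod.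
case eo: (v %% 4)%N => [|[|[|[|]]]] // _; have := down _ eo => {down eo}; last first.
- move=> ev; have hu : (v %/ 4 * 4 + 1 < n)%N by lia.
  apply: (below _ _ hu); first by apply: IH; lia.
  rewrite ev snakeE // !divnMDl // addn0 !leqnSn /grid_adj /=; lia.
- move=> ev; have hu : (v %/ 4 * 4 + 0 < n)%N by lia.
  apply: (below _ _ hu); first by apply: IH; lia.
  rewrite ev snakeE // !divnMDl // addn0 !leqnSn /grid_adj /=; lia.
- move=> ev; have hu : (v %/ 4 * 4 + 0 < n)%N by lia.
  apply: (below _ _ hu); first by apply: IH; lia.
  rewrite ev snakeE // !divnMDl // addn0 !leqnSn /grid_adj /=; lia.
case: (v %/ 4)%N => [|i] ev.
  by rewrite (_ : Ordinal hv = Ordinal n0) //; apply: val_inj.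
have /grid_adjP := stepP i; have := upP i.
have straight o : (o < 4)%N -> snake P (i * 4 + o) v ->
    connect (@snake_graph P n) (Ordinal n0) (Ordinal hv).
  move=> ho h; have hu : (i * 4 + o < n)%N by lia.
  by apply: (below _ _ hu _ _ h); apply: IH; lia.
(* After a step left or down, corner 0 is on the far side and is reached through another corner of
   its own block, which is complete because [i < T]. *)
have detour o o' : (i < T)%N -> (o < 4)%N -> (o' < 4)%N ->
    snake P (i * 4 + o) (i.+1 * 4 + o') -> snake P (i.+1 * 4 + o') v ->
    connect (@snake_graph P n) (Ordinal n0) (Ordinal hv).
  move=> hi ho ho' h1 h2; have hu : (i * 4 + o < n)%N by lia.
  have hw : (i.+1 * 4 + o' < n)%N by lia.
  apply: (below _ _ hw _ _ h2); apply: (below _ _ hu _ _ h1).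
  by apply: IH; lia.
move=> up; case=> e.
- by apply: (straight 1%N) => //; rewrite ev snakeE // e /grid_adj /=; lia.
- apply: (@detour 0 1)%N => //; last 2 first.
  + rewrite snakeE // e /grid_adj /=; lia.
  + rewrite ev snakeE // e /grid_adj /=; lia.
  by case: ltnP => // /up []; rewrite e /=; lia.
- by apply: (straight 2%N) => //; rewrite ev snakeE // e /grid_adj /=; lia.
- apply: (@detour 0 2)%N => //; last 2 first.
  + rewrite snakeE // e /grid_adj /=; lia.
  + rewrite ev snakeE // e /grid_adj /=; lia.
  by case: ltnP => // /up [_]; rewrite e /=; lia.
Qed.

(** * Hairpins *)

(* Abscissa, on the antidiagonal [t], of the staircase whose [q]-th pair of steps
   right and pair of steps up come in this order if bit [q] of [x] is set, and in
   the reverse order otherwise. *)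
Definition stair (x : seq bool) (t : nat) : nat :=
  t %/ 4 * 2 + (if nth false x (t %/ 4) then minn (t %% 4) 2 else t %% 4 - 2).

(* Index [T] is the turn, and index [i] lies on the antidiagonal [|i - T| + 2].
   The extra bit 0, opposite on the two arms, makes them meet at the turn. *)
Definition hairpin (m : nat) (x y : seq bool) (i : nat) : int * int :=
  let T := m * 4 + 2 in
  if i <= T then let t := T - i + 2 in
    ((stair (true :: x) t)%:Z, t%:Z - (stair (true :: x) t)%:Z)%R
  else let t := i - T + 2 in
    ((stair (false :: y) t)%:Z + 2, t%:Z - (stair (false :: y) t)%:Z - 2)%R.

Lemma stairS x t : stair x t <= stair x t.+1 <= (stair x t).+1.
Proof.
rewrite /stair; have [h|h] : t.+1 %/ 4 = t %/ 4 /\ t.+1 %% 4 = (t %% 4).+1 \/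
  t.+1 %/ 4 = (t %/ 4).+1 /\ t.+1 %% 4 = 0 /\ t %% 4 = 3 by lia.
- by case: h => -> ->; case: nth; lia.
- by case: h => -> [-> ->]; case: nth; case: nth; lia.
Qed.

Lemma hairpin_left m x y i : i <= m * 4 + 2 ->
  hairpin m x y i = ((stair (true :: x) (m * 4 + 2 - i + 2))%:Z,
   (m * 4 + 2 - i + 2)%N%:Z - (stair (true :: x) (m * 4 + 2 - i + 2))%:Z)%R.
Proof. by rewrite /hairpin => ->. Qed.

Lemma hairpin_right m x y i : m * 4 + 2 <= i ->
  hairpin m x y i = ((stair (false :: y) (i - (m * 4 + 2) + 2))%:Z + 2,
   (i - (m * 4 + 2) + 2)%N%:Z - (stair (false :: y) (i - (m * 4 + 2) + 2))%:Z - 2)%R.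
Proof.
rewrite leq_eqVlt => /orP[/eqP <-|h]; last by rewrite /hairpin leqNgt h.
by rewrite /hairpin leqnn subnn.
Qed.

(** Index [m * 4 + 3], just after the turn, is on antidiagonal 3, still governed by the extra bit.
    Thus the turn and its successor are common to all hairpins. *)
Lemma hairpin_prefix m x y y' i : i <= m * 4 + 3 ->
  hairpin m x y i = hairpin m x y' i.
Proof.
rewrite leq_eqVlt => /orP[/eqP ->|h]; last by rewrite !hairpin_left //; lia.
rewrite !hairpin_right; try lia.
by rewrite (_ : m * 4 + 3 - (m * 4 + 2) + 2 = 3); last lia.
Qed.

Lemma hairpin_suffix m x x' y i : m * 4 + 2 <= i ->
  hairpin m x y i = hairpin m x' y i.
Proof. by move=> h; rewrite !hairpin_right. Qed.

Lemma hairpin_up m x y i : m * 4 + 2 <= i ->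
  ((hairpin m x y i).1 <= (hairpin m x y i.+1).1 /\
   (hairpin m x y i).2 <= (hairpin m x y i.+1).2)%R.
Proof.
move=> h; rewrite !hairpin_right /=; try lia.
have := stairS (false :: y) (i - (m * 4 + 2) + 2).
rewrite (_ : i.+1 - (m * 4 + 2) + 2 = (i - (m * 4 + 2) + 2).+1); lia.
Qed.

Lemma hairpin_step m x y i : grid_adj (hairpin m x y i) (hairpin m x y i.+1).
Proof.
rewrite /grid_adj; case: (ltnP i (m * 4 + 2)) => h.
  rewrite !hairpin_left /=; try lia.
  have := stairS (true :: x) (m * 4 + 2 - i.+1 + 2).
  rewrite (_ : m * 4 + 2 - i + 2 = (m * 4 + 2 - i.+1 + 2).+1); lia.
rewrite !hairpin_right /=; try lia.
have := stairS (false :: y) (i - (m * 4 + 2) + 2).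
rewrite (_ : i.+1 - (m * 4 + 2) + 2 = (i - (m * 4 + 2) + 2).+1); lia.
Qed.

(** Bit [j] governs group [j.+1]. Halfway through it, a set bit has gained two units to the right
    over a clear one, exactly the shift between the arms. *)
Lemma hairpin_collision m x y j : j < m -> nth false x j -> ~~ nth false y j ->
  hairpin m x y (m * 4 + 2 - (j * 4 + 4)) = hairpin m x y (m * 4 + 2 + (j * 4 + 4)).
Proof.
move=> hj xj yj; rewrite hairpin_left; last lia.
rewrite hairpin_right; last lia.
rewrite (_ : _ - (_ - _) + 2 = j.+1 * 4 + 2); last lia.
rewrite (_ : _ + _ - _ + 2 = j.+1 * 4 + 2); last lia.
have q : (j.+1 * 4 + 2) %/ 4 = j.+1 by lia.
have r : (j.+1 * 4 + 2) %% 4 = 2 by lia.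
by rewrite /stair q r [nth _ (true :: x) _]/= [nth _ (false :: y) _]/= xj (negbTE yj);
  apply: pair_ext => /=; lia.
Qed.

Lemma stair_head b c x t : 4 <= t -> stair (b :: x) t = stair (c :: x) t.
Proof. by rewrite /stair => h; case E: (t %/ 4) => [|q] //; lia. Qed.

(** From antidiagonal 4 on, the arms are the same staircase shifted by 2; antidiagonal 3 is
    computed. The inequalities exclude a meeting on one antidiagonal and an adjacency between two
    consecutive ones, in both directions. *)
Lemma stair_gap x t : 3 <= t ->
  stair (true :: x) t < stair (false :: x) t + 2 /\
  stair (true :: x) t.+1 < stair (false :: x) t + 2 /\
  stair (true :: x) t + 1 < stair (false :: x) t.+1 + 2.
Proof.
rewrite leq_eqVlt => /orP[/eqP <-|h]; first by rewrite /stair /=; case: nth; lia.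
have h' : 4 <= t.+1 by lia.
rewrite (stair_head true false x h) (stair_head true false x h').
have := stairS (false :: x) t; lia.
Qed.

Lemma hairpin_inj m x : injective (hairpin m x x).
Proof.
suff H i j : i < j -> hairpin m x x i <> hairpin m x x j.
  by move=> i j e; case: (ltngtP i j) => // /H; rewrite e.
move=> ij; case: (leqP j (m * 4 + 2)) => hj; first by rewrite !hairpin_left; try lia; case; lia.
case: (leqP i (m * 4 + 2)) => hi; last by rewrite !hairpin_right; try lia; case; lia.
rewrite hairpin_left // hairpin_right; last lia.
case=> e1 e2.
have tu : m * 4 + 2 - i + 2 = j - (m * 4 + 2) + 2 by lia.
have [] := @stair_gap x (j - (m * 4 + 2) + 2); first lia.
rewrite tu in e1; lia.
Qed.

Lemma hairpin_adj m x i j : grid_adj (hairpin m x x i) (hairpin m x x j) -> i <= j.+1.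
Proof.
suff H k l : k.+1 < l -> ~~ grid_adj (hairpin m x x k) (hairpin m x x l).
  by move=> a; rewrite leqNgt; apply/negP => /H; rewrite grid_adj_sym a.
rewrite /grid_adj => kl; case: (leqP l (m * 4 + 2)) => hl.
  by rewrite !hairpin_left /=; lia.
case: (leqP k (m * 4 + 2)) => hk; last by rewrite !hairpin_right /=; lia.
rewrite hairpin_left // hairpin_right /=; last lia.
set t := m * 4 + 2 - k + 2; set u := l - (m * 4 + 2) + 2.
have [tu|[tu|tu]] : t = u.+1 \/ u = t.+1 \/ (t != u.+1 /\ u != t.+1) by lia.
- have [] := @stair_gap x u; first lia.
  rewrite tu; lia.
(* Here [t = 2] would make [k] the turn and [l] its successor, against [kl]. *)
- have [] := @stair_gap x t; first lia.
  rewrite tu; lia.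
- lia.
Qed.

(** * Gluing certificates *)

Lemma eq_nbr_view n (e e' : rel 'I_n) id (c c' : cert_assign n) v :
  e v =1 e' v -> (forall u, e v u -> c u = c' u) ->
  nbr_view e id c v = nbr_view e' id c' v.
Proof.
move=> ee cc; rewrite /nbr_view.
have -> : enum [pred u | e' v u] = enum [pred u | e v u].
  by apply: eq_enum => u; rewrite !inE ee.
by congr sort; apply/eq_in_map => u; rewrite mem_enum inE => /cc ->.
Qed.

(** Words of length at most [s] are counted in a type of [(s + 1) * 2^s] elements. *)
Definition pad (s : nat) (l : seq bool) : 'I_s.+1 * s.-tuple bool :=
  (inord (size l), [tuple nth false l i | i < s]).

Lemma pad_inj s l l' : size l <= s -> size l' <= s -> pad s l = pad s l' -> l = l'.
Proof.
move=> hl hl' e; have := congr1 (fun p => val p.1) e.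
rewrite /= !inordK // => es; apply: (@eq_from_nth _ false) => // i hi.
have := congr1 (fun p => tnth p.2 (Ordinal (leq_trans hi hl))) e.
by rewrite /= !tnth_mktuple.
Qed.

(** The accepted hairpins are induced subgraphs and the glued one is not even a subgraph, so any
    class in between is covered. A collision occurs by block [8 * m + 2], which is complete once
    [32 * m + 12 <= n]. *)
Lemma lower_bound (C : graph_class) k V s m n :
  (forall n e, @grid_induced_subgraph n e -> C n e) ->
  (forall n e, C n e -> @grid_subgraph n e) ->
  1 <= k -> pls C k V s -> m * 32 + 20 <= n -> m <= 16 * s n.
Proof.
move=> indC Csub hk [complete sound] hn.
pose T := m * 4 + 2.
pose G x y : rel 'I_n := @snake_graph (hairpin m x y) n.
have graphG x y : is_graph (G x y).
  apply: (@snake_graph_connected _ _ T); first exact: hairpin_step.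
    by move=> i; apply: hairpin_up.
  by rewrite /T; lia.
pose id (v : 'I_n) := (v.+1 : nat).
have validid : valid_ids k id.
  split=> [u v [] /val_inj //|v]; rewrite /id /=.
  by apply: leq_trans (ltn_ord v) _; rewrite -[X in X <= _]expn1 leq_pexp2l //; lia.
have /fin_all_exists [c hc] (x : m.-tuple bool) : exists c : cert_assign n,
    (forall v, size (c v) <= s n) /\ all_accept V (G x x) id c.
  apply: complete => //; apply: indC; apply: snake_graph_induced.
    exact: hairpin_inj.
  by move=> i j; apply: hairpin_adj.
have hv (o : 'I_8) : T * 4 + o < n by have := ltn_ord o; rewrite /T; lia.
pose key (x : m.-tuple bool) := [ffun o : 'I_8 => pad (s n) (c x (Ordinal (hv o)))].
have [inj|/injectivePn [x [y xy keyxy]]] := boolP (injectiveb key).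
  have := leq_card key (injectiveP _ inj).
  (* Since [s + 1 <= 2^s], each of the eight certificates takes at most [2^(2 * s)] values. *)
  rewrite card_tuple card_bool card_ffun card_prod !card_ord card_tuple card_bool => h.
  rewrite -(@leq_exp2l 2) //; apply: leq_trans h _.
  rewrite (_ : 16 * s n = (s n + s n) * 8); last lia.
  by rewrite expnM leq_exp2r // expnD leq_mul2r ltn_expl ?orbT.
exfalso.
have cut (v : 'I_n) : T <= v %/ 4 <= T.+1 -> c x v = c y v.
  move=> h; have o8 : v - T * 4 < 8 by lia.
  have := congr1 (fun f : {ffun _ -> _} => f (Ordinal o8)) keyxy; rewrite /= !ffunE.
  have -> : Ordinal (hv (Ordinal o8)) = v by apply: val_inj => /=; lia.
  by apply: pad_inj; [case: (hc x)|case: (hc y)].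
have [j xyj] : exists j : 'I_m, tnth x j != tnth y j.
  case: (pickP (fun j => tnth x j != tnth y j)) => [j|e]; first by exists j.
  by move: xy; rewrite (_ : x = y) ?eqxx //; apply: eq_from_tnth => j; apply/eqP/negbFE/e.
wlog [xj yj] : x y cut xyj {xy keyxy} / tnth x j /\ ~~ tnth y j.
  move=> H; case xj: (tnth x j) (xyj) => yj; first by apply: (H x y) => //; rewrite xj.
  apply: (H y x) => //; first by move=> v /cut.
    by rewrite eq_sym.
  by rewrite xj; case: (tnth y j) yj.
rewrite !(tnth_nth false) in xj yj.
have notC : ~ C n (G x y).
  move/Csub; apply: (@snake_collision _ _ _ _ _ _ _ _ (hairpin_collision (ltn_ord j) xj yj)).
  - exact: hairpin_step.
  - by have := ltn_ord j; lia.
  - by have := ltn_ord j; lia.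
  - by lia.
(* Both choices agree on blocks [T] and [T.+1]. Hence a vertex up to block [T] has the same view as
   in [G x x], and any later vertex the same view as in [G y y]. *)
pose d (v : 'I_n) := if v %/ 4 <= T then c x v else c y v.
apply: (sound _ _ id (graphG x y) validid notC d) => v.
have dx (u : 'I_n) : u %/ 4 <= T.+1 -> d u = c x u.
  by move=> h1; rewrite /d; case: leqP => h2 //; rewrite cut //; lia.
have dy (u : 'I_n) : T <= u %/ 4 -> d u = c y u.
  by move=> h1; rewrite /d; case: leqP => h2 //; rewrite cut //; lia.
have posL u : u %/ 4 <= T.+1 -> snake_pos (hairpin m x y) u = snake_pos (hairpin m x x) u.
  by move=> h; rewrite /snake_pos (@hairpin_prefix m x y x) //; lia.
have posR u : T <= u %/ 4 -> snake_pos (hairpin m x y) u = snake_pos (hairpin m y y) u.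
  by move=> h; rewrite /snake_pos (@hairpin_suffix m x y y).
case: (leqP (v %/ 4) T) => h.
- have [_ /(_ v)] := hc x; rewrite dx; last exact: leqW.
  rewrite (@eq_nbr_view _ (G x x) (G x y) _ (c x) d) // => u.
    rewrite /G /snake_graph /snake; case: (leqP (u %/ 4) (v %/ 4).+1) => h1;
      last by rewrite /= !andbF.
    by rewrite !posL //; lia.
  by case/and3P => _ h1 _; rewrite dx //; lia.
- have [_ /(_ v)] := hc y; rewrite dy; last exact: ltnW.
  rewrite (@eq_nbr_view _ (G y y) (G x y) _ (c y) d) // => u.
    rewrite /G /snake_graph /snake; case: (leqP (v %/ 4) (u %/ 4).+1) => h1; last by [].
    by rewrite !posR //; lia.
  by case/and3P => h1 _ _; rewrite dy //; lia.
Qed.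

Lemma grid_class_Theta_n k induced :
  0 < k -> local_complexity_Theta_n (grid_class induced) k.
Proof.
move=> hk; split.
  exists (grid_verifier induced), (fun n => (16 + 2 * k) * n), (16 + 2 * k), 0.
  split=> //; split=> n e id ge ide; first exact: grid_verifier_complete.
  by move=> nC c acc; apply: nC; apply: grid_verifier_sound ge ide acc.
(* From [(n - 20) %/ 32 <= 16 * s n] follows [n <= 512 * s n + 51]. For [n >= 52] the quotient is
   positive, so [s n >= 1] absorbs the 51. *)
exists 563, 52; split=> // V s pV n hn.
have indsub m (e : rel 'I_m) : grid_induced_subgraph e -> grid_subgraph e.
  by case=> f [injf ef]; exists f; split=> // u v; rewrite ef.
have low : (n - 20) %/ 32 <= 16 * s n.
  apply: (lower_bound _ _ hk pV); last by lia.
    by case: induced {pV} => // m e; apply: indsub.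
  by case: induced {pV} => // m e; apply: indsub.
lia.
Qed.

Theorem theorem5p7 (k : nat) (hk : (1 <= k)%N) :
  local_complexity_Theta_n grid_subgraph k /\
  local_complexity_Theta_n grid_induced_subgraph k.
Proof.
by split; [exact: (@grid_class_Theta_n k false)|exact: (@grid_class_Theta_n k true)].
Qed.
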